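(* For any $a\in\mathbb{N}$, the following identities of differential operators hold: (1) $d\circ\mathcal{D}^{i\to i-1}_{-a-1,a}=-\gamma\big(-a+i-\frac{n+1}2,a\big)\,\mathcal{D}^{i\to i}_{-a-1,a+1}$ for $1\le i\le n-1$. (2) $d\circ\mathcal{D}^{i\to i}_{-a,a}=0$ for $0\le i\le n-2$. (3) $d^*\circ\mathcal{D}^{i\to i}_{n-2i-a-1,a}=-\gamma\big(-a-i+\frac{n-1}2,a\big)\,\mathcal{D}^{i\to i-1}_{n-2i-a-1,a+1}$ for $1\le i\le n-1$. (4) $d^*\circ\mathcal{D}^{i\to i-1}_{n-2i-a,a}=0$ for $2\le i\le n$. Here the outer $d$ and $d^*$ are those of $\mathbb{R}^{n-1}$.
   Context: $n\ge2$; $\mathbb{N}=\{0,1,2,\dots\}$; $\mathcal{E}^i$: smooth complex-valued $i$-forms; $d$ the exterior derivative, $d^*$ its formal adjoint for the flat metric. $\mathbb{R}^{n-1}=\{x_n=0\}\subset\mathbb{R}^n$, $\mathrm{Rest}_{x_n=0}$ is pull-back of forms, $\iota_{\partial/\partial x_n}$ interior multiplication, $\Delta_{\mathbb{R}^{n-1}}=\sum_{j=1}^{n-1}\partial^2/\partial x_j^2$. For $\mu\in\mathbb{C}$, $\ell\in\mathbb{N}$, $$\mathcal{D}^\mu_\ell=\sum_{k=0}^{[\ell/2]}\frac{2^{\ell-2k}}{k!(\ell-2k)!}\Big(\prod_{m=[(\ell+1)/2]}^{\ell-k-1}(\mu+m)\Big)\Delta_{\mathbb{R}^{n-1}}^k\Big(\frac{\partial}{\partial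 x_n}\Big)^{\ell-2k}$$ (empty product $=1$), acting coefficientwise on forms on $\mathbb{R}^n$, and $\mathcal{D}^\mu_\ell=0$ for $\ell<0$. $\gamma(\mu,a)=1$ for $a$ odd, $=\mu+\frac a2$ for $a$ even. For $u\in\mathbb{C}$, $a\in\mathbb{N}$ and $\mu:=u+i-\frac{n-1}2$, the operators $\mathcal{D}^{i\to i-1}_{u,a}:\mathcal{E}^i(\mathbb{R}^n)\to\mathcal{E}^{i-1}(\mathbb{R}^{n-1})$ ($1\le i\le n$) and $\mathcal{D}^{i\to i}_{u,a}:\mathcal{E}^i(\mathbb{R}^n)\to\mathcal{E}^{i}(\mathbb{R}^{n-1})$ ($0\le i\le n-1$) are $$\mathcal{D}^{i\to i-1}_{u,a}=\mathrm{Rest}_{x_n=0}\circ\Big(-\mathcal{D}^{\mu+1}_{a-2}dd^*\iota_{\frac{\partial}{\partial x_n}}-\gamma(\mu,a)\mathcal{D}^{\mu+1}_{a-1}d^*+\tfrac12(u+2i-n)\mathcal{D}^\mu_a\iota_{\frac{\partial}{\partial x_n}}\Big),$$ $$\mathcal{D}^{i\to i}_{u,a}=\mathrm{Rest}_{x_n=0}\circ\Big(\mathcal{D}^{\mu+1}_{a-2}dd^*-\gamma(\mu-\tfrac12,a)\mathcal{D}^{\mu}_{a-1}d\,\iota_{\frac{\partial}{\partial x_n}}+\tfrac12(u+a)\mathcal{D}^\mu_a\Big),$$ with $d,d^*$ on $\mathbb{R}^n$ inside the parentheses. *)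

(* Defs.v *)
From HB Require Import structures.
From mathcomp Require Import all_boot all_order all_algebra.
From mathcomp Require Import complex.
From mathcomp Require Import all_classical all_reals all_analysis.
From mathcomp Require Import ring.
Set Implicit Arguments.
Unset Strict Implicit.
Unset Printing Implicit Defensive.
Import Order.TTheory GRing.Theory Num.Theory.
Import numFieldNormedType.Exports.
Local Open Scope ring_scope.

Section Forms.
Variable R : realType.

(* [R[i]] carries no normed-module structure over [R] in the library, so a
   complex-valued function is differentiated through its real and imaginary
   parts. *)
Definition partial n (j : 'I_n) (f : 'rV[R]_n -> R[i]) : 'rV[R]_n -> R[i] :=
  fun x => Complex ('D_(delta_mx 0 j) (fun y => complex.Re (f y)) x)
                   ('D_(delta_mx 0 j) (fun y => complex.Im (f y)) x).

Fixpoint Ck n (k : nat) (g : 'rV[R]_n -> R) : Prop :=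
  continuous g /\
  match k with
  | 0 => True
  | k'.+1 => forall j : 'I_n,
      (forall x, derivable g x (delta_mx 0 j)) /\
      Ck k' (fun x => 'D_(delta_mx 0 j) g x)
  end.

Definition smooth n (f : 'rV[R]_n -> R[i]) : Prop :=
  forall k, Ck k (fun x => complex.Re (f x)) /\ Ck k (fun x => complex.Im (f x)).

Definition pderivable n (j : 'I_n) (f : 'rV[R]_n -> R[i]) (x : 'rV[R]_n) :=
  derivable (fun y => complex.Re (f y)) x (delta_mx 0 j) /\
  derivable (fun y => complex.Im (f y)) x (delta_mx 0 j).

Lemma smooth_pderivable n j (f : 'rV[R]_n -> R[i]) x : smooth f -> pderivable j f x.
Proof. by move=> /(_ 1)[[_ /(_ j)[hr _]] [_ /(_ j)[hi _]]]; exact: conj (hr x) (hi x). Qed.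

Section PartialTheory.
Variables (n : nat) (j : 'I_n) (x : 'rV[R]_n).
Implicit Types f g : 'rV[R]_n -> R[i].

Lemma pderivable_cst c : pderivable j (fun=> c) x.
Proof. by split; exact: derivable_cst. Qed.

Lemma partial_cst c : partial j (fun=> c) x = 0.
Proof. by rewrite /partial !derive_cst. Qed.

Lemma pderivable_conj f : pderivable j f x -> pderivable j (fun y => (f y)^*) x.
Proof.
case=> h1 h2; split.
  by rewrite (_ : (fun y => _) = (fun y => complex.Re (f y)))//;
    apply/funext => y; case: (f y).
rewrite (_ : (fun y => _) = - (fun y => complex.Im (f y))); first exact: (derivableN h2).
by apply/funext => y /=; rewrite fctE; case: (f y).
Qed.

Lemma partial_conj f : pderivable j f x ->
  partial j (fun y => (f y)^*) x = (partial j f x)^*.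
Proof.
case=> h1 h2; rewrite /partial.
rewrite (_ : (fun y => complex.Re _) = (fun y => complex.Re (f y))); last first.
  by apply/funext => y; case: (f y).
rewrite (_ : (fun y => complex.Im (_^*)) = - (fun y => complex.Im (f y))); last first.
  by apply/funext => y /=; rewrite fctE; case: (f y).
by rewrite (deriveN h2).
Qed.

Lemma ReM_fun f g : (fun y => complex.Re (f y * g y)) =
  (fun y => complex.Re (f y)) * (fun y => complex.Re (g y))
  - (fun y => complex.Im (f y)) * (fun y => complex.Im (g y)).
Proof. by apply/funext => y /=; rewrite !fctE; case: (f y) (g y) => ? ? [? ?]. Qed.

Lemma ImM_fun f g : (fun y => complex.Im (f y * g y)) =
  (fun y => complex.Re (f y)) * (fun y => complex.Im (g y))
  + (fun y => complex.Im (f y)) * (fun y => complex.Re (g y)).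
Proof. by apply/funext => y /=; rewrite !fctE; case: (f y) (g y) => ? ? [? ?]. Qed.

Lemma pderivableM f g : pderivable j f x -> pderivable j g x ->
  pderivable j (fun y => f y * g y) x.
Proof.
move=> [f1 f2] [g1 g2]; split; rewrite ?ReM_fun ?ImM_fun.
  exact: (derivableB (derivableM f1 g1) (derivableM f2 g2)).
exact: (derivableD (derivableM f1 g2) (derivableM f2 g1)).
Qed.

Lemma partialM f g : pderivable j f x -> pderivable j g x ->
  partial j (fun y => f y * g y) x = partial j f x * g x + f x * partial j g x.
Proof.
move=> [f1 f2] [g1 g2]; rewrite /partial ReM_fun ImM_fun.
rewrite (deriveB (derivableM f1 g1) (derivableM f2 g2)).
rewrite (deriveD (derivableM f1 g2) (derivableM f2 g1)).
rewrite (deriveM f1 g1) (deriveM f2 g2) (deriveM f1 g2) (deriveM f2 g1).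
move: ('D_ _ _ x) ('D_ _ _ x) ('D_ _ _ x) ('D_ _ _ x) => f1' g1' f2' g2'.
case: (f x) (g x) => [c d] [c' d'] /=; apply/eqP; rewrite eq_complex /=.
by rewrite /GRing.scale /=; apply/andP; split; apply/eqP; ring.
Qed.

Lemma pderivable_partialD f g : pderivable j f x -> pderivable j g x ->
  pderivable j (fun y => f y + g y) x /\
  partial j (fun y => f y + g y) x = partial j f x + partial j g x.
Proof.
move=> [f1 f2] [g1 g2]; rewrite /pderivable /partial.
rewrite (_ : (fun y => complex.Re (f y + _)) =
  (fun y => complex.Re (f y)) + (fun y => complex.Re (g y))); last first.
  by apply/funext => y /=; rewrite fctE raddfD.
rewrite (_ : (fun y => complex.Im (f y + _)) =
  (fun y => complex.Im (f y)) + (fun y => complex.Im (g y))); last first.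
  by apply/funext => y /=; rewrite fctE raddfD.
rewrite (deriveD f1 g1) (deriveD f2 g2); split; last by [].
by split; [exact: (derivableD f1 g1) | exact: (derivableD f2 g2)].
Qed.

Lemma pderivable_partial_sum (I : finType) (F : I -> 'rV[R]_n -> R[i]) :
  (forall i, pderivable j (F i) x) ->
  pderivable j (fun y => \sum_i F i y) x /\
  partial j (fun y => \sum_i F i y) x = \sum_i partial j (F i) x.
Proof.
move=> dF; elim: (index_enum I) => [|i s [IH1 IH2]].
  rewrite big_nil (_ : (fun y => _) = fun=> 0); last first.
    by apply/funext => y; rewrite big_nil.
  by rewrite partial_cst; split => //; exact: pderivable_cst.
rewrite big_cons (_ : (fun y => _) = fun y => F i y + \sum_(k <- s) F k y); last first.
  by apply/funext => y; rewrite big_cons.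
by have [? ->] := pderivable_partialD (dF i) IH1; rewrite IH2.
Qed.

Lemma pderivable_sum (I : finType) (F : I -> 'rV[R]_n -> R[i]) :
  (forall i, pderivable j (F i) x) -> pderivable j (fun y => \sum_i F i y) x.
Proof. by move=> /pderivable_partial_sum[]. Qed.

Lemma partial_sum (I : finType) (F : I -> 'rV[R]_n -> R[i]) :
  (forall i, pderivable j (F i) x) ->
  partial j (fun y => \sum_i F i y) x = \sum_i partial j (F i) x.
Proof. by move=> /pderivable_partial_sum[]. Qed.

End PartialTheory.

(* A form w on R^n is the family of its coefficients in the global frame:
   w = \sum_I w I dx_I, where dx_I = dx_(i_1) /\ ... /\ dx_(i_p) for
   I = {i_1 < ... < i_p}.  The coordinates x_1, ..., x_n are indexed
   here by 0, ..., n-1, so that x_n has index [ord_max : 'I_n]. *)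
Definition dform n := {set 'I_n} -> 'rV[R]_n -> R[i].

(* w belongs to E^i(R^n). *)
Definition smooth_form n (i : nat) (w : dform n) : Prop :=
  (forall I : {set 'I_n}, smooth (w I)) /\
  (forall (I : {set 'I_n}) x, #|I| != i -> w I x = 0).

Definition form_add n (v w : dform n) : dform n := fun I x => v I x + w I x.
Definition form_opp n (w : dform n) : dform n := fun I x => - w I x.
Definition form_scale n (c : R[i]) (w : dform n) : dform n := fun I x => c * w I x.

(* dx_j /\ dx_I = \sum_J ext_coef j J I dx_J. *)
Definition ext_coef n (j : 'I_n) (J I : {set 'I_n}) : R[i] :=
  if (j \notin I) && (J == (j |: I)%SET) then (-1) ^+ #|[set k in I | (k < j)%N]%SET|
  else 0.

(* The first-order operator \sum_j A_j d/dx_j with constant coefficient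
   matrices A_j. *)
Definition diffop n (A : 'I_n -> {set 'I_n} -> {set 'I_n} -> R[i]) (w : dform n)
  : dform n :=
  fun J x => \sum_(j < n) \sum_(I : {set 'I_n}) A j J I * partial j (w I) x.

(* The dx_I are orthonormal for the flat metric, so the formal adjoint of
   \sum_j A_j d/dx_j is - \sum_j (A_j)^* d/dx_j, where (A_j)^* is the conjugate
   transpose; see [diffop_formal_adjoint]. *)
Definition formal_adjoint n (A : 'I_n -> {set 'I_n} -> {set 'I_n} -> R[i])
  : 'I_n -> {set 'I_n} -> {set 'I_n} -> R[i] :=
  fun j I J => - (A j J I)^*.

(* d w = \sum_j dx_j /\ (dw/dx_j). *)
Definition ext_d n : dform n -> dform n := diffop (@ext_coef n).
Definition dstar n : dform n -> dform n := diffop (formal_adjoint (@ext_coef n)).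

(* Green's identity: the difference of the two pointwise Hermitian products is
   a divergence, so it integrates to 0 when v or w has compact support. *)
Lemma diffop_formal_adjoint n A (v w : dform n) x :
  (forall I : {set 'I_n}, smooth (v I)) -> (forall I : {set 'I_n}, smooth (w I)) ->
  \sum_(J : {set 'I_n}) diffop A v J x * (w J x)^*
  - \sum_(I : {set 'I_n}) v I x * (diffop (formal_adjoint A) w I x)^*
  = \sum_(j < n) partial j (fun y =>
      \sum_(J : {set 'I_n}) \sum_(I : {set 'I_n}) A j J I * v I y * (w J y)^*) x.
Proof.
move=> sv sw.
have dv I j : pderivable j (v I) x by exact: smooth_pderivable.
have dw I j : pderivable j (w I) x by exact: smooth_pderivable.
transitivity (\sum_(j < n) \sum_(J : {set 'I_n}) \sum_(I : {set 'I_n})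
   (A j J I * partial j (v I) x * (w J x)^*
    + A j J I * v I x * (partial j (w J) x)^*)); last first.
  apply: eq_bigr => j _; rewrite partial_sum => [|J]; last first.
    apply: pderivable_sum => I; apply: pderivableM; last exact: pderivable_conj.
    by apply: pderivableM => //; exact: pderivable_cst.
  apply: eq_bigr => J _; rewrite partial_sum => [|I]; last first.
    apply: pderivableM; last exact: pderivable_conj.
    by apply: pderivableM => //; exact: pderivable_cst.
  apply: eq_bigr => I _; rewrite partialM; last exact: pderivable_conj.
    by rewrite partialM // ?partial_cst ?partial_conj ?mul0r ?add0r //;
      exact: pderivable_cst.
  by apply: pderivableM => //; exact: pderivable_cst.
have -> : \sum_(J : {set 'I_n}) diffop A v J x * (w J x)^* =
    \sum_(j < n) \sum_(J : {set 'I_n}) \sum_(I : {set 'I_n})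
       A j J I * partial j (v I) x * (w J x)^*.
  rewrite exchange_big /=; apply: eq_bigr => J _; rewrite /diffop mulr_suml.
  by apply: eq_bigr => j _; rewrite mulr_suml.
have -> : \sum_(I : {set 'I_n}) v I x * (diffop (formal_adjoint A) w I x)^* =
    - \sum_(j < n) \sum_(J : {set 'I_n}) \sum_(I : {set 'I_n})
       A j J I * v I x * (partial j (w J) x)^*.
  rewrite -sumrN; under [RHS]eq_bigr do rewrite exchange_big /= -sumrN.
  rewrite [RHS]exchange_big /=; apply: eq_bigr => I _.
  rewrite /diffop rmorph_sum mulr_sumr; apply: eq_bigr => j _.
  rewrite rmorph_sum mulr_sumr -sumrN; apply: eq_bigr => J _.
  by rewrite /formal_adjoint rmorphM rmorphN /= conjCK mulNr mulrN mulrCA mulrA.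
rewrite opprK -big_split /=; apply: eq_bigr => j _.
by rewrite -big_split /=; apply: eq_bigr => J _; rewrite -big_split.
Qed.

(* iota_(d/dx_j). *)
Definition contraction n (j : 'I_n) (w : dform n) : dform n :=
  fun I x => if j \in I then 0
             else (-1) ^+ #|[set k in I | (k < j)%N]%SET| * w (j |: I)%SET x.

Definition hyperplane_incl m (y : 'rV[R]_m) : 'rV[R]_m.+1 :=
  \row_k (if unlift ord_max k is Some l then y 0 l else 0).

(* Pull-back along [hyperplane_incl]: dx_n is killed and the other dx_j are
   preserved. *)
Definition rest m (w : dform m.+1) : dform m :=
  fun I y => w (lift ord_max @: I)%SET (hyperplane_incl y).

Definition tangential_laplacian m (f : 'rV[R]_m.+1 -> R[i]) : 'rV[R]_m.+1 -> R[i] :=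
  fun x => \sum_(j < m) partial (lift ord_max j) (partial (lift ord_max j) f) x.

Definition Dfun m (mu : R[i]) (l : nat) (f : 'rV[R]_m.+1 -> R[i])
  : 'rV[R]_m.+1 -> R[i] :=
  fun x => \sum_(0 <= k < (l./2).+1)
    (2 ^+ (l - 2 * k) / (k`!%:R * (l - 2 * k)`!%:R)
     * \prod_((l.+1)./2 <= p < l - k) (mu + p%:R))
    * iter k (@tangential_laplacian m) (iter (l - 2 * k) (partial ord_max) f) x.

(* D^mu_l acting coefficientwise, extended by 0 to l < 0. *)
Definition Dop m (mu : R[i]) (l : int) (w : dform m.+1) : dform m.+1 :=
  match l with
  | Posz l' => fun I => Dfun mu l' (w I)
  | Negz _ => fun _ _ => 0
  end.

Definition gamma_ (mu : R[i]) (a : nat) : R[i] :=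
  if odd a then 1 else mu + a%:R / 2.

(* With n = m.+1: mu = u + i - (n - 1)/2. *)
Definition mu_ (m i : nat) (u : R[i]) : R[i] := u + i%:R - m%:R / 2.

(* D^{i -> i-1}_{u,a} : E^i(R^(m.+1)) -> E^(i-1)(R^m). *)
Definition D_down m (i : nat) (u : R[i]) (a : nat) (w : dform m.+1) : dform m :=
  let mu := mu_ m i u in
  rest (form_add (form_add
    (form_opp (Dop (mu + 1) (a%:Z - 2) (ext_d (dstar (contraction ord_max w)))))
    (form_opp (form_scale (gamma_ mu a) (Dop (mu + 1) (a%:Z - 1) (dstar w)))))
    (form_scale (2^-1 * (u + (2 * i)%:R - (m.+1)%:R))
       (Dop mu a%:Z (contraction ord_max w)))).

(* D^{i -> i}_{u,a} : E^i(R^(m.+1)) -> E^i(R^m). *)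
Definition D_same m (i : nat) (u : R[i]) (a : nat) (w : dform m.+1) : dform m :=
  let mu := mu_ m i u in
  rest (form_add (form_add
    (Dop (mu + 1) (a%:Z - 2) (ext_d (dstar w)))
    (form_opp (form_scale (gamma_ (mu - 2^-1) a)
       (Dop mu (a%:Z - 1) (ext_d (contraction ord_max w))))))
    (form_scale (2^-1 * (u + a%:R)) (Dop mu a%:Z w))).

End Forms.

(* Main.v *)
Require Import Defs.
From HB Require Import structures.
From mathcomp Require Import all_boot all_order all_algebra.
From mathcomp Require Import complex.
From mathcomp Require Import all_classical all_reals all_analysis.
From mathcomp Require Import ring zify.
Set Implicit Arguments.
Unset Strict Implicit.
Unset Printing Implicit Defensive.
Import Order.TTheory GRing.Theory Num.Theory.
Import numFieldNormedType.Exports.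
Local Open Scope ring_scope.

(** Split a form on R^n along the hyperplane as [w = w0 + dx_n /\ w1], where
    neither [w0] nor [w1] involves [dx_n]. Write [d'] and [ds'] for the exterior
    derivative and codifferential in the first n-1 variables, [Z] for d/dx_n
    and [T] for the Laplacian of the first n-1 variables. The tangential part of
    [d w] is [d' w0], that of [d* w] is [ds' w0 - Z w1], and pull-back to the
    hyperplane only sees tangential parts and turns [d'], [ds'] into the outer
    operators. Both families of operators therefore become polynomial expressions
    in [d'], [ds'], [T], [Z] applied to the pair [(w0, w1)] ([down_op] and
    [same_op]), and the four identities are consequences of the relations
    [d' d' = 0], [ds' ds' = 0], [d' ds' + ds' d' = - T] and of the fact that [Z]
    commutes with everything.

    The last coefficient of each operator is where the special value of u enters.
    The outer d kills every term of [same_op] but the last, whose coefficient is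
    then zero; it kills the first term of [down_op], and the other two match the
    terms of [same_op] of the next order because the product of two values of
    gamma is the last coefficient ([gamma_mul_half]). For the outer d*,
    comparing coefficients reduces the claim to three recurrences between the
    polynomials D^mu_l and D^(mu+1)_l in [T] and [Z]:
    - [gegen_lower_sum]: T D^(mu+1)_(a-2) + gamma(mu,a) Z D^(mu+1)_(a-1)
      = (a/2) D^mu_a;
    - [gegen_three_term]: (mu+a) D^mu_a - T D^(mu+1)_(a-2)
      = (mu+[(a+1)/2]) D^(mu+1)_a;
    - [gegen_contiguous]: gamma(mu,a) D^(mu+1)_(a-1)
      - gamma(mu-1/2,a) D^mu_(a-1) = Z D^(mu+1)_(a-2).
    They hold coefficientwise, since each coefficient is an elementary factor
    times a rising factorial in mu.

    The relations between [d'], [ds'] and [T] combine the Clifford relations of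
    exterior and interior multiplication with the symmetry of second partial
    derivatives, [derive_comm], which follows from the mean value theorem. *)

(** * Coefficients of the Gegenbauer-type operators *)
Section GegenbauerCoefficients.
Variable R : realType.
Local Notation C := R[i].
Implicit Types (x mu : C) (k q r a l : nat).

Definition rising x r : C := \prod_(p < r) (x + p%:R).

Lemma risingSr x r : rising x r.+1 = rising x r * (x + r%:R).
Proof. by rewrite /rising big_ord_recr. Qed.

Lemma risingSl x r : rising x r.+1 = x * rising (x + 1) r.
Proof.
rewrite /rising big_ord_recl addr0; congr (_ * _).
by apply: eq_bigr => p _; rewrite /= /bump /= add1n -natr1; ring.
Qed.

(** The coefficients are indexed by the exponents [k] of the tangential Laplacian
    and [q] of the normal derivative, the order being [l = 2 * k + q]: in these
    variables the recurrences below shift one exponent at a time. *)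
Definition gpref k q : C := 2 ^+ q / (k`!%:R * q`!%:R).

Lemma gprefSk k q : k.+1%:R * gpref k.+1 q = gpref k q.
Proof.
rewrite /gpref factS natrM.
have nz p : p`!%:R != 0 :> C by rewrite pnatr_eq0 -lt0n fact_gt0.
by field; rewrite !nz nat1r pnatr_eq0.
Qed.

Lemma gprefSq k q : q.+1%:R / 2 * gpref k q.+1 = gpref k q.
Proof.
rewrite /gpref exprS factS natrM.
have nz p : p`!%:R != 0 :> C by rewrite pnatr_eq0 -lt0n fact_gt0.
by field; rewrite !nz nat1r pnatr_eq0.
Qed.

(** The product over [(l + 1)/2 <= m < l - k] has [q./2] factors and starts at
    [k + uphalf q], because [(l + 1)./2 = k + uphalf q]. *)
Definition gcoef mu k q : C :=
  gpref k q * rising (mu + (k + uphalf q)%:R) q./2.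

Lemma gcoefSk mu k q : k.+1%:R * gcoef mu k.+1 q = gcoef (mu + 1) k q.
Proof.
by rewrite /gcoef mulrA gprefSk addSn -nat1r addrA.
Qed.

(** For even [q > 0] this is the first factor of the rising factorial in
    [gcoef mu k q], whence the role of [gamma_] in the recurrences. *)
Lemma gamma_addn mu k q :
  gamma_ mu (2 * k + q) = if odd q then 1 else mu + (k + q./2)%:R.
Proof.
rewrite /gamma_ oddD oddM /=; case: ifPn => // qev.
rewrite -{1}(odd_double_half q) (negPf qev) add0n -mul2n -mulnDr natrM.
by rewrite mulrC mulKf // pnatr_eq0.
Qed.

(** The shift of [mu] moves the start of the rising factorial; for even [q] the
    number of factors is unchanged, and for odd [q] the missing first factor is
    the value of [gamma_]. *)
Lemma gcoefSq mu k q :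
  gamma_ mu (2 * k + q.+1) * gcoef (mu + 1) k q = q.+1%:R / 2 * gcoef mu k q.+1.
Proof.
rewrite /gcoef [RHS]mulrA gprefSq gamma_addn /= uphalf_half.
have -> : mu + 1 + (k + (odd q + q./2))%:R = mu + (k + q./2.+1 + odd q)%:R.
  by rewrite -addrA nat1r; congr (mu + _%:R); lia.
case: (odd q) => /=; last by rewrite mul1r addn0.
rewrite add1n risingSl addn1 -natr1 !addrA; ring.
Qed.

(** With [x] the start of the rising factorial and [h = q./2], dividing out the
    common factors leaves [(x + 1 + h) - x = h + 1] for odd [q] and
    [(x + h) - (x - 1/2) = h + 1/2] for even [q]; both are [(q + 1)/2], which
    lowers the factorials by [gprefSq]. *)
Lemma gcoef_contiguousS mu k q :
  gamma_ mu (2 * k + q.+2) * gcoef (mu + 1) k q.+1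
  - gamma_ (mu - 2^-1) (2 * k + q.+2) * gcoef mu k q.+1 = gcoef (mu + 1) k q.
Proof.
rewrite /gcoef -(gprefSq k q) !gamma_addn /= uphalf_half.
set h := q./2; set x := mu + (k + h.+1)%:R.
have hq : q.+1%:R = 1 + (odd q)%:R + 2 * h%:R :> C.
  by rewrite /h -natrM -addrA -natrD nat1r; congr _%:R; lia.
have e1 b : mu + 1 + (k + (b + h))%:R = x + b%:R.
  by rewrite /x -addrA nat1r -addrA -natrD; congr (mu + _%:R); lia.
have -> : mu + 1 + (k + h.+1)%:R = x + 1 by rewrite /x; ring.
have -> : mu - 2^-1 + (k + h.+1)%:R = x - 2^-1 by rewrite /x; ring.
rewrite e1 {}hq -/x; case: (odd q) => /=; rewrite ?add1n ?add0n ?addr0 ?mul1r.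
  by rewrite risingSr [rising x _]risingSl; field.
by rewrite [x * _]mulrCA -risingSl risingSr; field.
Qed.

(** Both sides are [rising x (q./2 + 1)] with [x = mu + k + uphalf q], once with
    the last and once with the first factor split off, as
    [q = uphalf q + q./2]. *)
Lemma gcoef_three_term mu k q :
  (mu + (2 * k + q)%:R) * gcoef mu k q - k%:R * gcoef mu k q
  = (mu + (k + uphalf q)%:R) * gcoef (mu + 1) k q.
Proof.
rewrite /gcoef; set x := mu + (k + _)%:R.
have -> : mu + 1 + (k + uphalf q)%:R = x + 1 by rewrite /x; ring.
rewrite [RHS]mulrCA -risingSl risingSr.
have -> : mu + (2 * k + q)%:R = x + (q./2)%:R + k%:R.
  by rewrite /x -!addrA -!natrD uphalf_half; congr (mu + _%:R); lia.
ring.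
Qed.

End GegenbauerCoefficients.

(** * Recurrences between the Gegenbauer-type operators *)

Section GegenbauerOperators.
Variables (R : realType) (V : lmodType R[i]) (T Z : {linear V -> V}).
Hypothesis commTZ : forall v, Z (T v) = T (Z v).
Local Notation C := R[i].
Implicit Types (mu : C) (k q a l : nat) (v : V).

(** The operator [D^mu_l] over an abstract module: [T] stands for the tangential
    Laplacian and [Z] for the normal derivative. *)
Definition gegen mu (l : int) v : V :=
  match l with
  | Posz l => \sum_(0 <= k < l./2.+1)
      gcoef mu k (l - 2 * k) *: iter k T (iter (l - 2 * k) Z v)
  | Negz _ => 0
  end.

(** Going from order [l] to [l + 1] raises the normal exponent [l - 2 * k] by one
    in every term; for odd [l] there is one further term, with normal exponent
    [0]. *)
Lemma big_half_succ l (F : nat -> nat -> V) :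
  \sum_(0 <= k < (l.+1)./2.+1) F k (l.+1 - 2 * k)%N =
  \sum_(0 <= k < l./2.+1) F k (l - 2 * k).+1
  + (if odd l then F (l.+1)./2 0%N else 0).
Proof.
have eqF : \sum_(0 <= k < l./2.+1) F k (l.+1 - 2 * k)%N =
           \sum_(0 <= k < l./2.+1) F k (l - 2 * k).+1.
  by apply: eq_big_nat => k /andP[_ kl]; congr (F k _); lia.
have [ol|el] := boolP (odd l); last first.
  by rewrite addr0 -eqF; congr (bigop _ (index_iota 0 _) _); lia.
have -> : (l.+1)./2 = l./2.+1 by lia.
by rewrite big_nat_recr //= eqF; congr (_ + F _ _); lia.
Qed.

Lemma iter_comm k v : Z (iter k T v) = iter k T (Z v).
Proof. by elim: k => //= k IH; rewrite commTZ IH. Qed.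

(** Multiplication by [T] raises the tangential exponent, and [gcoefSk] rewrites
    the coefficient as a multiple of the one of [D^mu_a]. *)
Lemma T_gegen mu a v : T (gegen (mu + 1) (a%:Z - 2) v) =
  \sum_(0 <= k < a./2.+1)
    (k%:R * gcoef mu k (a - 2 * k)) *: iter k T (iter (a - 2 * k) Z v).
Proof.
case: a => [|[|l]]; rewrite ?linear0 ?big_nat1 ?mul0r ?scale0r //.
have -> : l.+2%:Z - 2 = l by lia.
rewrite [RHS]big_nat_recl // mul0r scale0r add0r linear_sum /=.
apply: eq_big_nat => k /andP[_ kl]; rewrite linearZ /= gcoefSk.
by rewrite (_ : l.+2 - 2 * k.+1 = l - 2 * k)%N //; lia.
Qed.

(** Likewise [Z] raises the normal exponent; the extra term with normal exponent
    [0] is harmless because its coefficient carries the factor [a - 2 * k]. *)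
Lemma Z_gegen mu a v :
  gamma_ mu a *: Z (gegen (mu + 1) (a%:Z - 1) v) =
  \sum_(0 <= k < a./2.+1)
    ((a - 2 * k)%:R / 2 * gcoef mu k (a - 2 * k)) *: iter k T (iter (a - 2 * k) Z v).
Proof.
case: a => [|l]; first by rewrite linear0 scaler0 big_nat1 !mul0r scale0r.
have -> : l.+1%:Z - 1 = l by lia.
rewrite (big_half_succ l (fun k q =>
  (q%:R / 2 * gcoef mu k q) *: iter k T (iter q Z v))).
rewrite !mul0r scale0r if_same addr0 linear_sum scaler_sumr.
apply: eq_big_nat => k /andP[_ kl]; rewrite linearZ /= iter_comm scalerA.
rewrite -gcoefSq; congr (gamma_ _ _ * _ *: _); lia.
Qed.

(** A Gegenbauer recurrence: [k] from [T_gegen] and [(a - 2 * k)/2] from [Z_gegen]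
    add up to [a/2], whatever the term. *)
Lemma gegen_lower_sum mu a v :
  T (gegen (mu + 1) (a%:Z - 2) v) + gamma_ mu a *: Z (gegen (mu + 1) (a%:Z - 1) v)
  = (a%:R / 2) *: gegen mu a v.
Proof.
rewrite T_gegen Z_gegen -big_split scaler_sumr /=.
apply: eq_big_nat => k /andP[_ kl]; rewrite -scalerDl scalerA -mulrDl.
rewrite (_ : a%:R = 2 * k%:R + (a - 2 * k)%:R :> C).
  by congr (_ * _ *: _); field.
by rewrite -natrM -natrD subnKC //; lia.
Qed.

Lemma gegen_three_term mu a v :
  (mu + a%:R) *: gegen mu a v - T (gegen (mu + 1) (a%:Z - 2) v)
  = (mu + (uphalf a)%:R) *: gegen (mu + 1) a v.
Proof.
rewrite T_gegen !scaler_sumr -sumrB.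
apply: eq_big_nat => k /andP[_ kl]; rewrite !scalerA -scalerBl.
have {1}-> : a = (2 * k + (a - 2 * k))%N by lia.
rewrite gcoef_three_term; congr ((mu + _%:R) * _ *: _); lia.
Qed.

(** For odd [a] the sums on the left have one term more than the right-hand side;
    it has normal exponent [0], where the coefficients do not depend on [mu] and
    cancel. *)
Lemma gegen_contiguous mu a v :
  gamma_ mu a *: gegen (mu + 1) (a%:Z - 1) v
  - gamma_ (mu - 2^-1) a *: gegen mu (a%:Z - 1) v
  = Z (gegen (mu + 1) (a%:Z - 2) v).
Proof.
case: a => [|[|l]]; first by rewrite !scaler0 [RHS]linear0 subr0.
  rewrite [RHS]linear0 /= !big_nat1 /gcoef /= /rising !big_ord0 /gamma_ /=.
  exact: subrr.
have -> : l.+2%:Z - 1 = l.+1 by lia.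
have -> : l.+2%:Z - 2 = l by lia.
rewrite /gegen !scaler_sumr -sumrB.
rewrite (big_half_succ l (fun k q =>
  gamma_ mu l.+2 *: (gcoef (mu + 1) k q *: iter k T (iter q Z v))
  - gamma_ (mu - 2^-1) l.+2 *: (gcoef mu k q *: iter k T (iter q Z v)))).
rewrite linear_sum -[RHS]addr0; congr (_ + _).
  apply: eq_big_nat => k /andP[_ kl]; rewrite [in RHS]linearZ /= iter_comm !scalerA.
  rewrite -scalerBl -[in RHS]gcoef_contiguousS.
  by rewrite (_ : (2 * k + _)%N = l.+2) //; lia.
case: ifP => // ol; rewrite /gamma_ /= ol !scale1r.
by rewrite /gcoef /rising !big_ord0 subrr.
Qed.

Fact gegen_is_linear mu (l : int) : linear (gegen mu l).
Proof.
move=> c u v; case: l => [l|l] /=; last by rewrite scaler0 addr0.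
have iterD (f : {linear V -> V}) k x y :
    iter k f (c *: x + y) = c *: iter k f x + iter k f y.
  by elim: k => //= k ->; rewrite linearP.
rewrite scaler_sumr -big_split /=; apply: eq_bigr => k _.
by rewrite !iterD scalerDr !scalerA mulrC.
Qed.

HB.instance Definition _ mu (l : int) :=
  GRing.isLinear.Build _ _ _ _ (gegen mu l) (gegen_is_linear mu l).

Lemma gegen_comm (f : {linear V -> V}) mu (l : int) v :
  (forall u, f (T u) = T (f u)) -> (forall u, f (Z u) = Z (f u)) ->
  f (gegen mu l v) = gegen mu l (f v).
Proof.
move=> fT fZ; case: l => [l|l] /=; last by rewrite linear0.
have fiter (g : V -> V) k x : (forall u, f (g u) = g (f u)) ->
  f (iter k g x) = iter k g (f x) by move=> fg; elim: k => //= k <-.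
rewrite linear_sum; apply: eq_bigr => k _.
by rewrite linearZ /= !fiter.
Qed.

End GegenbauerOperators.
Arguments gegen : simpl never.

(** * The factorization identities, algebraically *)
Section GammaFactors.
Variable R : realType.
Implicit Types (mu : R[i]) (a : nat).

(** Exactly one of [a] and [a + 1] is even, so one factor is [1]; the shift
    by [1/2] makes the other one the same for both parities. *)
Lemma gamma_mul_half mu a :
  gamma_ mu a * gamma_ (mu - 2^-1) a.+1 = mu + a%:R / 2.
Proof. by rewrite /gamma_ /= -(@natr1 _ a); case: (odd a) => /=; field. Qed.

Lemma gamma_mul_succ mu a :
  gamma_ mu a * gamma_ mu a.+1 = mu + (uphalf a)%:R.
Proof.
have ha : a%:R = (odd a)%:R + 2 * (a./2)%:R :> R[i].
  by rewrite -natrM -natrD; congr _%:R; lia.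
by rewrite /gamma_ /= -(@natr1 _ a) ha uphalf_half natrD; case: (odd a) => /=; field.
Qed.

End GammaFactors.

(** The four identities with the geometry removed. The maps [d] and [ds] stand
    for the exterior derivative and the codifferential of the hyperplane, [Z] for
    the normal derivative and [T] for the Laplacian of the hyperplane. *)
Section FactorizationIdentities.
Variables (R : realType) (V : lmodType R[i]) (d ds T Z : {linear V -> V}).
Hypothesis dd0 : forall v, d (d v) = 0.
Hypothesis dsds0 : forall v, ds (ds v) = 0.
Hypothesis hodge : forall v, d (ds v) + ds (d v) = - T v.
Hypothesis commdZ : forall v, d (Z v) = Z (d v).
Hypothesis commdsZ : forall v, ds (Z v) = Z (ds v).
Local Notation C := R[i].
Local Notation D := (gegen T Z).
Implicit Types (mu c : C) (a : nat) (v w : V).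

Lemma laplacianE v : T v = - (d (ds v) + ds (d v)).
Proof. by rewrite hodge opprK. Qed.

Lemma commTZ v : Z (T v) = T (Z v).
Proof. by rewrite !laplacianE linearN linearD /= !(commdZ, commdsZ). Qed.

Lemma commdT v : d (T v) = T (d v).
Proof. by rewrite !laplacianE linearN linearD /= !dd0 linear0 addr0 add0r. Qed.

Lemma commdsT v : ds (T v) = T (ds v).
Proof. by rewrite !laplacianE linearN linearD /= !dsds0 linear0 addr0 add0r. Qed.

Lemma d_gegen mu (l : int) v : d (D mu l v) = D mu l (d v).
Proof. exact: gegen_comm commdT commdZ. Qed.

Lemma ds_gegen mu (l : int) v : ds (D mu l v) = D mu l (ds v).
Proof. exact: gegen_comm commdsT commdsZ. Qed.

Lemma T_gegen_comm mu (l : int) v : T (D mu l v) = D mu l (T v).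
Proof. by apply: gegen_comm => // u; rewrite commTZ. Qed.

Lemma Z_gegen_comm mu (l : int) v : Z (D mu l v) = D mu l (Z v).
Proof. by apply: gegen_comm => // u; rewrite commTZ. Qed.

(** What [D^{i -> i-1}] and [D^{i -> i}] become on a form [w0 + dx_n /\ w1], seen
    on the hyperplane: there [d* w] is [ds w0 - Z w1], while [iota], [d iota] and
    [d d* iota] give [w1], [d w1] and [d (ds w1)]. The scalar [c] keeps the last
    coefficient free, as each identity uses one special value of it. *)
Definition down_op mu c a (w0 w1 : V) : V :=
  - D (mu + 1) (a%:Z - 2) (d (ds w1))
  - gamma_ mu a *: D (mu + 1) (a%:Z - 1) (ds w0 - Z w1)
  + c *: D mu a w1.

Definition same_op mu c a (w0 w1 : V) : V :=
  D (mu + 1) (a%:Z - 2) (d (ds w0 - Z w1))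
  - gamma_ (mu - 2^-1) a *: D mu (a%:Z - 1) (d w1)
  + c *: D mu a w0.

Let succB1 a : a.+1%:Z - 1 = a. Proof. by lia. Qed.
Let succB2 a : a.+1%:Z - 2 = a%:Z - 1. Proof. by lia. Qed.

(** Applying [d] kills [d (ds w1)] and turns the other two terms of [down_op] into
    the first two terms of [same_op]; the scalar is [gamma_mul_half]. *)
Lemma d_down_op mu a w0 w1 :
  d (down_op mu (mu + a%:R / 2) a w0 w1)
  = - (gamma_ mu a *: same_op mu 0 a.+1 w0 w1).
Proof.
rewrite /down_op /same_op succB1 succB2 scale0r addr0.
rewrite !(linearD d, linearN d, linearZZ d) !d_gegen dd0 linear0 oppr0 add0r.
by rewrite scalerDr scalerN scalerA gamma_mul_half opprD opprK (linearB d).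
Qed.

Lemma d_same_op mu a w0 w1 : d (same_op mu 0 a w0 w1) = 0.
Proof.
rewrite /same_op scale0r addr0 (linearB d) (linearZZ d) !d_gegen !dd0 !linear0.
by rewrite addr0.
Qed.

(** The [w0] part is [gegen_three_term], because [ds d ds = - T ds]. In the [w1]
    part the left-hand side collapses by [gegen_contiguous]; on the right
    [d ds = - T - ds d] and the [T] and [Z] terms cancel against the last term of
    [down_op] by [gegen_lower_sum]. *)
Lemma ds_same_op mu a w0 w1 :
  ds (same_op mu (mu + a%:R) a w0 w1)
  = - (gamma_ mu a *: down_op mu (- (a.+1%:R / 2)) a.+1 w0 w1).
Proof.
have dsdds : ds (d (ds w0)) = - T (ds w0).
  by rewrite -hodge dsds0 linear0 add0r.
have ddsE : d (ds w1) = - T w1 - ds (d w1) by rewrite -hodge addrK.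
transitivity ((mu + (uphalf a)%:R) *: D (mu + 1) a (ds w0)
              - gamma_ mu a *: D (mu + 1) (a%:Z - 1) (ds (d w1))).
  rewrite /same_op !(linearD ds, linearN ds, linearZZ ds) !ds_gegen.
  rewrite !(linearB ds, linearB d) commdZ commdsZ dsdds.
  rewrite -(gegen_three_term T Z) T_gegen_comm.
  (* make room for the left-hand side of [gegen_contiguous] *)
  rewrite -[gamma_ mu a *: _](subrK
    (gamma_ (mu - 2^-1) a *: D mu (a%:Z - 1) (ds (d w1)))).
  rewrite (gegen_contiguous commTZ) Z_gegen_comm linearB linearN /= opprD.
  by rewrite [LHS]addrC [in RHS]opprD !addrA.
have low := gegen_lower_sum commTZ mu a.+1 w1.
rewrite succB1 succB2 T_gegen_comm Z_gegen_comm in low.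
rewrite /down_op succB1 succB2 scaleNr -low ddsE.
rewrite (linearB (D _ _)) (linearN (D _ _)) (linearB (D _ _)).
have cancel (u v x y : V) c : - (- u - v) - c *: (x - y) - (u + c *: y) = v - c *: x.
  by rewrite scalerBr !opprB opprK [v + u]addrC addrACA [LHS]addrC addKr.
by rewrite cancel scalerBr scalerA gamma_mul_succ opprB.
Qed.

(** Only [ds w1] survives, with the coefficient
    [T D_(a-2) + gamma Z D_(a-1) - (a/2) D_a], which [gegen_lower_sum] makes zero. *)
Lemma ds_down_op mu a w0 w1 :
  ds (down_op mu (- (a%:R / 2)) a w0 w1) = 0.
Proof.
have dsdds : ds (d (ds w1)) = - T (ds w1).
  by rewrite -hodge dsds0 linear0 add0r.
rewrite /down_op !(linearD ds, linearN ds, linearZZ ds) !ds_gegen !(linearB ds).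
rewrite commdsZ dsdds dsds0 sub0r !linearN /= scaleNr -(gegen_lower_sum commTZ).
by rewrite T_gegen_comm Z_gegen_comm !opprK subrr.
Qed.

End FactorizationIdentities.

(** * Exterior and interior multiplication *)
Section KoszulSign.
Variables (R : realType) (n : nat).
Local Notation C := R[i].
Implicit Types (j k : 'I_n) (J : {set 'I_n}).

(** The sign of moving [dx_j] past the factors of [dx_J] that precede it. *)
Definition ksign j J : C := (-1) ^+ #|[set k in J | (k < j)%N]%SET|.

Lemma ksign_sqr j J : ksign j J * ksign j J = 1.
Proof. by rewrite -expr2 sqrr_sign. Qed.

Lemma ksignU1 j k J : k \notin J ->
  ksign j (k |: J)%SET = (-1) ^+ (k < j)%N * ksign j J.
Proof.
move=> kJ; rewrite /ksign -exprD; congr (_ ^+ _).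
rewrite (_ : [set l in k |: J | (l < j)%N]%SET =
   (if (k < j)%N then [set k]%SET else finset.set0)
     :|: [set l in J | (l < j)%N])%SET; last first.
  apply/setP => l; rewrite !inE; case: ifP => kj; rewrite !inE;
  by case: eqVneq => [->|] //=; rewrite kj ?orbT ?andbF.
rewrite cardsU (_ : _ :&: _ = finset.set0)%SET ?cards0 ?subn0.
  by case: ifP; rewrite ?cards1 ?cards0.
apply/setP => l; case: ifP; rewrite !inE // => _.
by case: eqVneq => // ->; rewrite (negPf kJ).
Qed.

Lemma ksignD1 j k J : k \in J ->
  ksign j (J :\ k)%SET = (-1) ^+ (k < j)%N * ksign j J.
Proof.
move=> kJ; rewrite -[in RHS](finset.setD1K kJ) ksignU1 ?finset.setD11 //.
by rewrite mulrA -signr_addb addbb mul1r.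
Qed.

Lemma ksignD1_self j J : j \in J -> ksign j (J :\ j)%SET = ksign j J.
Proof. by move=> jJ; rewrite ksignD1 // ltnn mul1r. Qed.

End KoszulSign.

(** Forms with coefficients in an arbitrary module [S]: exterior and interior
    multiplications satisfy the Clifford relations, and this is all that
    [d d = 0], [d* d* = 0] and [d d* + d* d = - Laplacian] depend on, besides
    commuting derivations. *)
Section CliffordAlgebra.
Variables (R : realType) (n : nat) (S : lmodType R[i]).
Local Notation C := R[i].
Local Notation V := ({set 'I_n} -> S).
Implicit Types (j k : 'I_n) (J : {set 'I_n}) (v : V).

Definition wedge j v : V :=
  fun J => if j \in J then ksign R j J *: v (J :\ j)%SET else 0.

Definition hook j v : V :=
  fun J => if j \in J then 0 else ksign R j J *: v (j |: J)%SET.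

Let sign_swap j k : j != k -> (-1) ^+ (j < k)%N = - (-1) ^+ (k < j)%N :> C.
Proof.
move=> jk; rewrite -signrN; congr ((-1) ^+ nat_of_bool _).
by rewrite -leqNgt ltn_neqAle val_eqE jk.
Qed.

Lemma wedge_anticomm j k v : wedge j (wedge k v) = - wedge k (wedge j v).
Proof.
apply/funext => J; rewrite fctE /wedge !inE.
have [->|jk] /= := eqVneq j k; first by rewrite !scaler0 if_same oppr0.
case: ifPn => jJ; case: ifPn => kJ; rewrite /= ?scaler0 ?oppr0 //.
rewrite !scalerA -scaleNr !ksignD1 // (sign_swap jk).
congr (_ *: v _); first by ring.
by rewrite !finset.setDDl finset.setUC.
Qed.

Lemma hook_anticomm j k v : hook j (hook k v) = - hook k (hook j v).
Proof.
apply/funext => J; rewrite fctE /hook !inE.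
have [->|jk] /= := eqVneq j k; first by rewrite !scaler0 if_same oppr0.
case: ifPn => jJ; case: ifPn => kJ; rewrite /= ?scaler0 ?oppr0 //.
rewrite !scalerA -scaleNr !ksignU1 // (sign_swap jk).
congr (_ *: v _); first by ring.
by rewrite finset.setUCA.
Qed.

(** For [j = k] exactly one of the two terms is present, according to whether
    [j \in J], and its sign is a square. For [j != k] both or none are, with
    signs that differ by the order of [j] and [k]. *)
Lemma wedge_hook_anticomm j k v :
  wedge j (hook k v) + hook k (wedge j v) = if j == k then v else 0.
Proof.
apply/funext => J; rewrite fctE /wedge /hook !inE.
have [->|jk] /= := eqVneq j k.
  case: ifPn => kJ.
    by rewrite addr0 scalerA ksignD1_self // ksign_sqr scale1r finset.setD1K.
  rewrite add0r scalerA ksignU1 // ltnn mul1r ksign_sqr scale1r.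
  by rewrite finset.setU1K.
case: ifPn => jJ; case: ifPn => kJ; rewrite /= ?scaler0 ?addr0 //.
rewrite !scalerA ksignD1 // ksignU1 // (sign_swap jk).
rewrite (_ : (k |: J) :\ j = k |: (J :\ j))%SET; last first.
  by apply/setP => l; rewrite !inE; case: eqVneq => // ->; rewrite (negPf jk).
rewrite -scalerDl (_ : _ + _ = 0) ?scale0r //; ring.
Qed.

Fact wedge_linear j : linear (wedge j).
Proof.
move=> c u v; apply/funext => J; rewrite /wedge !fctE.
case: ifP => _; last by rewrite scaler0 addr0.
by rewrite scalerDr !scalerA mulrC.
Qed.
HB.instance Definition _ j := GRing.isLinear.Build _ _ _ _ (wedge j) (wedge_linear j).

Fact hook_linear j : linear (hook j).
Proof.
move=> c u v; apply/funext => J; rewrite /hook !fctE.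
case: ifP => _; first by rewrite scaler0 addr0.
by rewrite scalerDr !scalerA mulrC.
Qed.
HB.instance Definition _ j := GRing.isLinear.Build _ _ _ _ (hook j) (hook_linear j).

(** A map on coefficients, acting on forms coefficientwise. *)
Definition postcomp (f : {linear S -> S}) v : V := f \o v.

Fact postcomp_linear f : linear (postcomp f).
Proof. by move=> c u v; apply/funext => J; rewrite /postcomp /= !fctE linearP. Qed.
HB.instance Definition _ f :=
  GRing.isLinear.Build _ _ _ _ (postcomp f) (postcomp_linear f).

Lemma postcomp_wedge f j v : postcomp f (wedge j v) = wedge j (postcomp f v).
Proof.
apply/funext => J; rewrite /postcomp /wedge /=.
by case: ifP => _; rewrite ?linear0 ?linearZZ.
Qed.

Lemma postcomp_hook f j v : postcomp f (hook j v) = hook j (postcomp f v).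
Proof.
apply/funext => J; rewrite /postcomp /hook /=.
by case: ifP => _; rewrite ?linear0 ?linearZZ.
Qed.

Lemma antisym_sum0 (F : 'I_n -> 'I_n -> V) :
  (forall j k, F j k = - F k j) -> \sum_j \sum_k F j k = 0.
Proof.
move=> FN; set s := LHS; have sN : s = - s.
  rewrite {1}/s exchange_big /= -sumrN; apply: eq_bigr => j _.
  by rewrite -sumrN; apply: eq_bigr => k _.
apply/eqP; have /eqP : 2%:R *: s = 0 :> V by rewrite scaler_nat mulr2n {1}sN addNr.
by rewrite scaler_eq0 pnatr_eq0.
Qed.

Section ExteriorDerivative.
Variable D : 'I_n -> {linear S -> S}.
Hypothesis commD : forall j k s, D j (D k s) = D k (D j s).

Definition extd v : V := \sum_j wedge j (postcomp (D j) v).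
Definition codiff v : V := - \sum_j hook j (postcomp (D j) v).
Definition lap v : V := \sum_j postcomp (D j) (postcomp (D j) v).

Fact extd_linear : linear extd.
Proof.
move=> c u v; rewrite /extd scaler_sumr -big_split; apply: eq_bigr => j _.
by rewrite !linearP.
Qed.
HB.instance Definition _ := GRing.isLinear.Build _ _ _ _ extd extd_linear.

Fact codiff_linear : linear codiff.
Proof.
move=> c u v; rewrite /codiff scalerN -opprD scaler_sumr -big_split.
by congr (- _); apply: eq_bigr => j _; rewrite !linearP.
Qed.
HB.instance Definition _ := GRing.isLinear.Build _ _ _ _ codiff codiff_linear.

Fact lap_linear : linear lap.
Proof.
move=> c u v; rewrite /lap scaler_sumr -big_split; apply: eq_bigr => j _.
by rewrite !linearP.
Qed.
HB.instance Definition _ := GRing.isLinear.Build _ _ _ _ lap lap_linear.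

Lemma postcompC j k v :
  postcomp (D j) (postcomp (D k) v) = postcomp (D k) (postcomp (D j) v).
Proof. by apply/funext => J; exact: commD. Qed.

(** The derivations commute and the exterior multiplications anticommute. *)
Lemma extd_extd v : extd (extd v) = 0.
Proof.
rewrite /extd; under eq_bigr do rewrite !linear_sum /=.
apply: antisym_sum0 => j k; rewrite !postcomp_wedge postcompC.
exact: wedge_anticomm.
Qed.

Lemma codiff_codiff v : codiff (codiff v) = 0.
Proof.
apply/eqP; rewrite oppr_eq0; apply/eqP.
under eq_bigr do rewrite !linearN !linear_sum /=.
apply: antisym_sum0 => j k; rewrite !postcomp_hook postcompC; congr (- _).
exact: hook_anticomm.
Qed.

(** Pairing the terms [(j, k)] of both products, the Clifford relation leaves only
    the diagonal [j = k]. *)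
Lemma extd_codiff_anticomm v : extd (codiff v) + codiff (extd v) = - lap v.
Proof.
rewrite /codiff linearN /= -opprD; congr (- _).
rewrite /extd; under [X in X + _]eq_bigr do rewrite !linear_sum /=.
under [X in _ + X]eq_bigr do rewrite !linear_sum /=.
rewrite [X in _ + X]exchange_big -big_split /=; apply: eq_bigr => j _.
rewrite -big_split /= (bigD1 j) //= big1 => [|k kj].
  by rewrite !postcomp_wedge !postcomp_hook wedge_hook_anticomm eqxx addr0.
rewrite !postcomp_wedge !postcomp_hook postcompC wedge_hook_anticomm.
by rewrite eq_sym (negPf kj).
Qed.

Lemma extd_postcomp (f : {linear S -> S}) v :
  (forall j s, f (D j s) = D j (f s)) -> extd (postcomp f v) = postcomp f (extd v).
Proof.
move=> fD; rewrite /extd linear_sum; apply: eq_bigr => j _.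
rewrite /= postcomp_wedge; congr wedge.
by apply/funext => J; rewrite /postcomp /= fD.
Qed.

Lemma codiff_postcomp (f : {linear S -> S}) v :
  (forall j s, f (D j s) = D j (f s)) -> codiff (postcomp f v) = postcomp f (codiff v).
Proof.
move=> fD; rewrite /codiff linearN (linear_sum (postcomp f)); congr (- _).
apply: eq_bigr => j _.
rewrite /= postcomp_hook; congr hook.
by apply/funext => J; rewrite /postcomp /= fD.
Qed.

End ExteriorDerivative.
End CliffordAlgebra.

(** * Symmetry of second derivatives *)
Section SymmetryOfSecondDerivatives.
Variables (R : realType) (V : normedModType R).
Implicit Types (g : V -> R) (u v x : V).

(** The difference quotient of [g] along the line is the one that defines
    ['D_v g], so the mean value theorem on the real line applies to
    directional derivatives. *)
Lemma is_derive_line g v x (t : R) : derivable g (t *: v + x) v ->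
  is_derive t 1 (fun s : R => g (s *: v + x)) ('D_v g (t *: v + x)).
Proof.
move=> dg.
have quotE : (fun h : R => h^-1 *: (((fun s : R => g (s *: v + x)) \o shift t) (h *: 1)
      - g (t *: v + x))) =
    (fun h : R => h^-1 *: ((g \o shift (t *: v + x)) (h *: v) - g (t *: v + x))).
  by apply/funext => h /=; rewrite [h *: 1]mulr1 scalerDl addrA.
by split; rewrite /derivable /derive quotE.
Qed.

(** Two applications of the mean value theorem: to the increment of [g] in the
    direction [v] as a function of the displacement along [u], then to ['D_u g]
    along [v]. *)
Lemma second_difference g u v x (h : R) : 0 < h ->
  (forall y, derivable g y u) -> (forall y, derivable ('D_u g) y v) ->
  exists s t : R, [/\ 0 < s < h, 0 < t < h &
    g (h *: u + (h *: v + x)) - g (h *: v + x) - (g (h *: u + x) - g x)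
    = 'D_v ('D_u g) (t *: v + (s *: u + x)) * h * h].
Proof.
move=> h0 dg ddg.
pose phi : R -> R :=
  (fun s : R => g (s *: u + (h *: v + x))) - (fun s : R => g (s *: u + x)).
have dphi (s : R) : is_derive s (1 : R) phi
    ('D_u g (s *: u + (h *: v + x)) - 'D_u g (s *: u + x)).
  by apply: is_deriveB; exact: is_derive_line.
have [|s shs phiE] := MVT h0 (fun s _ => dphi s).
  by apply: derivable_within_continuous => s _; exact: ex_derive.
pose psi : R -> R := fun t : R => 'D_u g (t *: v + (s *: u + x)).
have dpsi (t : R) : is_derive t (1 : R) psi ('D_v ('D_u g) (t *: v + (s *: u + x))).
  exact: is_derive_line.
have [|t tht psiE] := MVT h0 (fun t _ => dpsi t).
  by apply: derivable_within_continuous => t _; exact: ex_derive.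
exists s, t; split; [by move: shs; rewrite in_itv | by move: tht; rewrite in_itv |].
move: phiE psiE; rewrite /phi /psi !fctE !scale0r !add0r !subr0 => phiE psiE.
by rewrite -psiE (addrCA (h *: v) (s *: u)) -phiE; ring.
Qed.

Lemma continuous_eq_near (A B : V -> R) x :
  {for x, continuous A} -> {for x, continuous B} ->
  (forall d : R, 0 < d ->
     exists p q, [/\ `|x - p| < d, `|x - q| < d & A p = B q]) ->
  A x = B x.
Proof.
move=> cA cB close; apply/eqP/negPn/negP => neqAB.
pose e := `|A x - B x| / 2.
have e0 : 0 < e by rewrite divr_gt0 // normr_gt0 subr_eq0.
move/cvgrPdist_lt : cA => /(_ e e0) cA; move/cvgrPdist_lt : cB => /(_ e e0) cB.
have /nbhs_normP[d /= d0 near_d] : \forall y \near x,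
    `|A x - A y| < e /\ `|B x - B y| < e by exact: filterI cA cB.
have [p [q [/near_d[Ap _] /near_d[_ Bq] pq]]] := close d d0.
have : `|A x - B x| < e + e.
  rewrite (le_lt_trans _ (ltrD Ap Bq)) // pq [X in _ <= _ + X]distrC.
  exact: ler_distD.
by rewrite -splitr ltxx.
Qed.

(** The second difference over the parallelogram spanned by [h u] and [h v] is
    symmetric in [u] and [v]; divided by [h * h], it is a value of each of the two
    mixed derivatives, at points that approach [x] with [h]. *)
Lemma derive_comm g u v x :
  (forall y, derivable g y u) -> (forall y, derivable g y v) ->
  (forall y, derivable ('D_u g) y v) -> (forall y, derivable ('D_v g) y u) ->
  {for x, continuous ('D_v ('D_u g))} -> {for x, continuous ('D_u ('D_v g))} ->
  'D_v ('D_u g) x = 'D_u ('D_v g) x.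
Proof.
move=> du dv dvu duv cA cB; apply: (continuous_eq_near cA cB) => d d0.
(* the summand [1] covers [u = v = 0] *)
pose h := d / (`|u| + `|v| + 1).
have n0 : 0 < `|u| + `|v| + 1 by rewrite ltr_wpDl // addr_ge0.
have h0 : 0 < h by rewrite divr_gt0.
have small s t : 0 < s < h -> 0 < t < h -> `|x - (t *: v + (s *: u + x))| < d.
  move=> /andP[s0 sh] /andP[t0 th].
  rewrite [in X in _ - X]addrA opprD addrCA subrr addr0 normrN.
  rewrite (le_lt_trans (ler_normD _ _)) // !normrZ !gtr0_norm //.
  have -> : d = h * `|v| + h * `|u| + h by rewrite /h; field; rewrite gt_eqF.
  rewrite (@le_lt_trans _ _ (h * `|v| + h * `|u|)) ?ltrDl //.
  by rewrite lerD // ler_wpM2r // ltW.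
have [s [t [sh th dE]]] := second_difference x h0 du dvu.
have [s' [t' [sh' th' dE']]] := second_difference x h0 dv duv.
exists (t *: v + (s *: u + x)), (t' *: u + (s' *: v + x)); split.
- exact: small.
- by rewrite addrCA; exact: small.
have hn : h != 0 by rewrite gt_eqF.
apply: (mulIf hn); apply: (mulIf hn); apply: (etrans (esym dE)).
by apply: (etrans _ dE'); rewrite (addrCA (h *: v) (h *: u)); ring.
Qed.

End SymmetryOfSecondDerivatives.

(** * The module of smooth functions *)
Section SmoothFunctions.
Variables (R : realType) (n : nat).
Local Notation C := R[i].
Local Notation U := 'rV[R]_n.

Lemma CkD k (f g : U -> R) : Ck k f -> Ck k g -> Ck k (fun x => f x + g x).
Proof.
elim: k f g => [|k IH] f g [cf df] [cg dg];
  have cfg : continuous (fun x => f x + g x) by move=> x; exact: (cvgD (cf x) (cg x)).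
  by [].
split=> // j; have [dfj Cfj] := df j; have [dgj Cgj] := dg j.
split=> [x|]; first exact: (derivableD (dfj x) (dgj x)).
rewrite (_ : (fun x => _) = (fun x =>
    'D_(delta_mx 0 j) f x + 'D_(delta_mx 0 j) g x)); first exact: IH.
by apply/funext => x; exact: (deriveD (dfj x) (dgj x)).
Qed.

Lemma CkZ k (c : R) (f : U -> R) : Ck k f -> Ck k (fun x => c * f x).
Proof.
elim: k f => [|k IH] f [cf df];
  have ccf : continuous (fun x => c * f x) by move=> x; exact: (cvgM (cvg_cst c) (cf x)).
  by [].
split=> // j; have [dfj Cfj] := df j.
have dcf x : derivable (fun y => c * f y) x (delta_mx 0 j) /\
    'D_(delta_mx 0 j) (fun y => c * f y) x = c * 'D_(delta_mx 0 j) f x.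
  rewrite (_ : (fun y => c * f y) = cst c * f) //; split.
    exact: (derivableM (derivable_cst _ _ _) (dfj x)).
  rewrite (deriveM (derivable_cst _ _ _) (dfj x)) derive_cst.
  by rewrite scaler0 addr0.
split=> [x|]; first exact: (dcf x).1.
rewrite (_ : (fun x => _) = (fun x => c * 'D_(delta_mx 0 j) f x)); first exact: IH.
by apply/funext => x; exact: (dcf x).2.
Qed.

Lemma Ck0 k : Ck k (fun _ : U => 0 : R).
Proof.
have c0 : continuous (fun _ : U => 0 : R) by exact: cst_continuous.
elim: k => [|k IH]; first by [].
split=> // j; split=> [x|]; first exact: derivable_cst.
by rewrite (_ : (fun x => _) = fun=> 0) //; apply/funext => x; exact: derive_cst.
Qed.

Lemma smoothD (f g : U -> C) : smooth f -> smooth g -> smooth (fun x => f x + g x).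
Proof.
move=> sf sg k; have [rf mf] := sf k; have [rg mg] := sg k; split.
  rewrite (_ : (fun x => _) = (fun x => complex.Re (f x) + complex.Re (g x))).
    exact: CkD.
  by apply/funext => x; case: (f x) (g x) => ? ? [].
rewrite (_ : (fun x => _) = (fun x => complex.Im (f x) + complex.Im (g x))).
  exact: CkD.
by apply/funext => x; case: (f x) (g x) => ? ? [].
Qed.

Lemma smoothZ (c : C) (f : U -> C) : smooth f -> smooth (fun x => c * f x).
Proof.
move=> sf k; have [rf mf] := sf k; case: c => a b; split.
  rewrite (_ : (fun x => _) = (fun x => a * complex.Re (f x) + (- b) * complex.Im (f x))).
    by apply: CkD; exact: CkZ.
  by apply/funext => x; case: (f x) => u v /=; rewrite mulNr.
rewrite (_ : (fun x => _) = (fun x => a * complex.Im (f x) + b * complex.Re (f x))).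
  by apply: CkD; exact: CkZ.
by apply/funext => x; case: (f x).
Qed.

Lemma smooth0 : smooth (fun _ : U => 0 : C).
Proof. by move=> k; split; exact: Ck0. Qed.

Lemma smooth_partial j (f : U -> C) : smooth f -> smooth (partial j f).
Proof. by move=> sf k; have [[_ /(_ j)[_ rf]] [_ /(_ j)[_ mf]]] := sf k.+1. Qed.

Lemma Ck2_derive_comm j k (g : U -> R) x : Ck 2 g ->
  'D_(delta_mx 0 j) ('D_(delta_mx 0 k) g) x = 'D_(delta_mx 0 k) ('D_(delta_mx 0 j) g) x.
Proof.
move=> [_ Cg]; have [dj [_ Cj]] := Cg j; have [dk [_ Ck]] := Cg k.
have [djk [cjk _]] := Cj k; have [dkj [ckj _]] := Ck j.
exact: (derive_comm dk dj dkj djk (ckj x) (cjk x)).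
Qed.

Lemma partial_comm j k (f : U -> C) : smooth f ->
  partial j (partial k f) = partial k (partial j f).
Proof.
move=> /(_ 2%N) [rf mf]; apply/funext => x.
exact: (f_equal2 (@Complex R) (Ck2_derive_comm j k x rf) (Ck2_derive_comm j k x mf)).
Qed.

Lemma partialZ j (c : C) (f : U -> C) x : smooth f ->
  partial j (fun y => c * f y) x = c * partial j f x.
Proof.
move=> sf; have df : pderivable j f x by exact: smooth_pderivable.
by rewrite (partialM (pderivable_cst _ _ c) df) partial_cst mul0r add0r.
Qed.

Definition smooth_pred : {pred U -> C^o} := fun f => `[< smooth f >].

Fact smooth_submod_closed : submod_closed smooth_pred.
Proof.
split=> [|c f g /asboolP sf /asboolP sg]; apply/asboolP; first exact: smooth0.
by apply: smoothD => //; exact: smoothZ.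
Qed.
HB.instance Definition _ :=
  GRing.isSubmodClosed.Build _ _ smooth_pred smooth_submod_closed.

(** Bundling smooth functions makes the partial derivatives linear endomorphisms
    of a module over the complex numbers that commute without side conditions. *)
Record smoothfun :=
  SmoothFun { smooth_val :> U -> C^o ; smooth_valP : smooth_val \in smooth_pred }.
HB.instance Definition _ := [isSub for smooth_val].
HB.instance Definition _ := [Choice of smoothfun by <:].
HB.instance Definition _ := [SubChoice_isSubLmodule of smoothfun by <:].

Lemma smoothfun_smooth (s : smoothfun) : smooth s.
Proof. exact/asboolP/smooth_valP. Qed.

Definition to_smooth (f : U -> C) (sf : smooth f) : smoothfun := SmoothFun (asboolT sf).

Lemma smoothfunP (s t : smoothfun) : (s : U -> C) = t -> s = t.
Proof. exact: val_inj. Qed.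

Definition spartial (j : 'I_n) (s : smoothfun) : smoothfun :=
  to_smooth (smooth_partial j (smoothfun_smooth s)).

Fact spartial_linear j : linear (spartial j).
Proof.
move=> c s t; apply: smoothfunP; apply/funext => x /=.
have sd (f : U -> C) : smooth f -> pderivable j f x by exact: smooth_pderivable.
have [ss st] := (smoothfun_smooth s, smoothfun_smooth t).
rewrite [LHS](pderivable_partialD (sd _ (smoothZ c ss)) (sd _ st)).2.
by rewrite partialZ.
Qed.
HB.instance Definition _ j :=
  GRing.isLinear.Build _ _ _ _ (spartial j) (spartial_linear j).

Lemma spartial_comm j k s : spartial j (spartial k s) = spartial k (spartial j s).
Proof. by apply: smoothfunP; apply: partial_comm; exact: smoothfun_smooth. Qed.

End SmoothFunctions.

(** * Forms near the hyperplane *)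
Section FormsInCoordinates.
Variables (R : realType) (n : nat).
Implicit Types (j : 'I_n) (I J : {set 'I_n}) (w : dform R n).

(** The matrix of [dx_j /\] read from the row [J] that it contributes to, which is
    how the coefficients of [d w] are computed. *)
Lemma ext_coefE j J I : ext_coef R j J I =
  if (j \in J) && (I == J :\ j)%SET then ksign R j J else 0.
Proof.
have -> : (j \in J) && (I == J :\ j)%SET = (j \notin I) && (J == j |: I)%SET.
  apply/andP/andP => -[jI /eqP ->]; rewrite ?inE ?eqxx //.
    by rewrite finset.setD1K // eqxx.
  by rewrite finset.setU1K // eqxx.
rewrite /ext_coef; case: ifP => // /andP[jI /eqP ->].
by rewrite ksignU1 // ltnn mul1r.
Qed.

Lemma ext_dE w J x : ext_d w J x =
  \sum_j if j \in J then ksign R j J * partial j (w (J :\ j)%SET) x else 0.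
Proof.
apply: eq_bigr => j _; case: ifPn => jJ; last first.
  by rewrite big1 // => I _; rewrite ext_coefE (negPf jJ) mul0r.
rewrite (bigD1 (J :\ j)%SET) //= big1 ?addr0 => [|I /negPf IJ].
  by rewrite ext_coefE jJ eqxx.
by rewrite ext_coefE IJ andbF mul0r.
Qed.

Lemma dstarE w J x : dstar w J x =
  - \sum_j if j \in J then 0 else ksign R j J * partial j (w (j |: J)%SET) x.
Proof.
rewrite -sumrN; apply: eq_bigr => j _; rewrite /formal_adjoint /ext_coef.
case: ifPn => jJ.
  by rewrite big1 ?oppr0 // => I _; rewrite rmorph0 oppr0 mul0r.
rewrite (bigD1 (j |: J)%SET) //= big1 ?addr0 => [|I /negPf IJ].
  by rewrite eqxx rmorphXn rmorphN1 mulNr.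
by rewrite IJ rmorph0 oppr0 mul0r.
Qed.

End FormsInCoordinates.

Section Hyperplane.
Variables (R : realType) (m : nat).
Local Notation C := R[i].
Local Notation S := (smoothfun R m.+1).
Local Notation V := ({set 'I_m} -> S).
(* the tangential indices of [J], inside the index set of the ambient space *)
Local Notation emb J := (lift ord_max @: J)%SET.
Implicit Types (j : 'I_m) (J : {set 'I_m}) (v : V) (w : dform R m.+1).

Lemma mem_emb j J : (lift ord_max j \in emb J) = (j \in J).
Proof. by rewrite mem_imset //; exact: lift_inj. Qed.

Lemma max_notin_emb J : (ord_max \in emb J) = false.
Proof. by apply/imsetP => -[j _ /eqP]; rewrite (negPf (neq_lift _ _)). Qed.

Lemma embU1 j J : (lift ord_max j |: emb J)%SET = emb (j |: J)%SET.
Proof. by rewrite finset.imsetU1. Qed.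

Lemma embD1 j J : (emb J :\ lift ord_max j)%SET = emb (J :\ j)%SET.
Proof.
apply/setP => k; rewrite !inE; case: (unliftP ord_max k) => [l ->|->].
  by rewrite !mem_emb !inE (inj_eq (@lift_inj _ _)).
by rewrite !max_notin_emb andbF.
Qed.

Lemma ksign_emb j J : ksign R (lift ord_max j) (emb J) = ksign R j J.
Proof.
rewrite /ksign -(card_imset _ (@lift_inj _ (@ord_max m))).
congr ((-1) ^+ #|pred_of_set _|).
apply/setP => k; rewrite inE; case: (unliftP ord_max k) => [l ->|->].
  by rewrite !mem_emb !inE !lift_max.
by rewrite !max_notin_emb.
Qed.

Definition tangential_partial j : {linear S -> S} := spartial (lift ord_max j).
Definition normal_partial : {linear S -> S} := spartial ord_max.

Local Notation d' := (extd tangential_partial).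
Local Notation ds' := (codiff tangential_partial).
Local Notation T := (lap tangential_partial).
Local Notation Z := (postcomp normal_partial).

Lemma smoothfun_sumE (I : Type) (r : seq I) (F : I -> S) x :
  (\sum_(i <- r) F i) x = \sum_(i <- r) F i x.
Proof. by elim/big_rec2: _ => // i y1 y2 _ <-. Qed.

Lemma smoothfun_oppE (s : S) x : (- s) x = - s x.
Proof. by []. Qed.

Lemma extdE v J x : d' v J x = \sum_j if j \in J
  then ksign R j J * partial (lift ord_max j) (v (J :\ j)%SET) x else 0.
Proof.
rewrite /extd fct_sumE smoothfun_sumE; apply: eq_bigr => j _.
by rewrite /wedge; case: ifP.
Qed.

Lemma codiffE v J x : ds' v J x = - \sum_j if j \in J then 0
  else ksign R j J * partial (lift ord_max j) (v (j |: J)%SET) x.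
Proof.
rewrite /codiff fctE smoothfun_oppE; congr (- _).
rewrite fct_sumE smoothfun_sumE; apply: eq_bigr => j _.
by rewrite /hook; case: ifP.
Qed.

Lemma lapE v J : smooth_val (T v J) = @tangential_laplacian R m (smooth_val (v J)).
Proof.
by apply/funext => x; rewrite /lap fct_sumE smoothfun_sumE.
Qed.

(** The coefficients of [w] on the [dx_I] without [dx_n], with their dependence on
    all coordinates kept: this is the [w0] of [w = w0 + dx_n /\ w1], and the
    [w1] is the tangential part of the contraction of [w] with d/dx_n. *)
Definition tangential_part v w := forall J, smooth_val (v J) = w (emb J).

(** Moving along the hyperplane is moving along a tangential coordinate of the
    ambient space, so the difference quotients agree. *)
Lemma partial_incl j (f : 'rV[R]_m.+1 -> C) y :
  partial j (fun z => f (hyperplane_incl z)) y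
  = partial (lift ord_max j) f (hyperplane_incl y).
Proof.
have inclD (h : R) : hyperplane_incl (h *: delta_mx 0 j + y) =
    h *: delta_mx 0 (lift ord_max j) + hyperplane_incl y.
  apply/rowP => k; rewrite !mxE; case: unliftP => [l ->|->].
    by rewrite !mxE (inj_eq (@lift_inj _ _)).
  by rewrite (negPf (neq_lift _ _)) andbF mulr0 addr0.
have diffE (g : 'rV[R]_m.+1 -> R) :
    'D_(delta_mx 0 j) (fun z => g (hyperplane_incl z)) y =
    'D_(delta_mx 0 (lift ord_max j)) g (hyperplane_incl y).
  have quotE : (fun h : R => h^-1 *: (((fun z => g (hyperplane_incl z)) \o shift y)
        (h *: delta_mx 0 j) - g (hyperplane_incl y))) =
      (fun h : R => h^-1 *: ((g \o shift (hyperplane_incl y))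
        (h *: delta_mx 0 (lift ord_max j)) - g (hyperplane_incl y))).
    by apply/funext => h /=; rewrite inclD.
  by rewrite /derive quotE.
by rewrite /partial !(diffE (fun z => _ (f z))).
Qed.

Lemma rest_tangential v w : tangential_part v w ->
  rest w = fun J y => v J (hyperplane_incl y).
Proof. by move=> vw; apply/funext => J; apply/funext => y; rewrite /rest vw. Qed.

Lemma ext_d_rest v : ext_d (fun J y => v J (hyperplane_incl y))
  = fun J y => d' v J (hyperplane_incl y).
Proof.
apply/funext => J; apply/funext => y; rewrite ext_dE extdE.
by apply: eq_bigr => j _; rewrite partial_incl.
Qed.

Lemma dstar_rest v : dstar (fun J y => v J (hyperplane_incl y))
  = fun J y => ds' v J (hyperplane_incl y).
Proof.
apply/funext => J; apply/funext => y; rewrite dstarE codiffE.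
by congr (- _); apply: eq_bigr => j _; rewrite partial_incl.
Qed.

(** The term [dx_n /\ dw/dx_n] only has coefficients on sets that contain [n]. *)
Lemma tangential_ext_d v w : tangential_part v w -> tangential_part (d' v) (ext_d w).
Proof.
move=> vw J; apply/funext => x; rewrite [LHS]extdE ext_dE.
rewrite (bigD1_ord ord_max) //= max_notin_emb add0r.
by apply: eq_bigr => j _; rewrite mem_emb ksign_emb embD1 vw.
Qed.

Lemma contraction_emb w J : Defs.contraction ord_max w (emb J)
  = fun x => ksign R ord_max (emb J) * w (ord_max |: emb J)%SET x.
Proof. by apply/funext => x; rewrite /Defs.contraction max_notin_emb. Qed.

(** The term of [d*] in the normal direction is [- d/dx_n] of the contraction; the
    others involve the tangential coefficients only. *)
Lemma tangential_dstar v c w : (forall I, smooth (w I)) ->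
  tangential_part v w ->
  tangential_part c (Defs.contraction ord_max w) ->
  tangential_part (ds' v - Z c) (dstar w).
Proof.
move=> sw vw cw J; apply/funext => x.
transitivity (ds' v J x - partial ord_max (c J) x); first by [].
rewrite codiffE dstarE (bigD1_ord ord_max) //= max_notin_emb opprD addrC.
congr (_ - _); last first.
  by apply: eq_bigr => j _; rewrite mem_emb ksign_emb embU1 vw.
by rewrite cw contraction_emb partialZ.
Qed.

Lemma tangential_add v1 v2 w1 w2 : tangential_part v1 w1 -> tangential_part v2 w2 ->
  tangential_part (v1 + v2) (form_add w1 w2).
Proof. by move=> h1 h2 J; rewrite /form_add -h1 -h2. Qed.

Lemma tangential_opp v w : tangential_part v w -> tangential_part (- v) (form_opp w).
Proof. by move=> h J; rewrite /form_opp -h. Qed.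

Lemma tangential_scale c v w : tangential_part v w ->
  tangential_part (c *: v) (form_scale c w).
Proof. by move=> h J; rewrite /form_scale -h. Qed.

Lemma Dfun_coefE (mu : C) l k : (k < l./2.+1)%N ->
  2 ^+ (l - 2 * k) / (k`!%:R * (l - 2 * k)`!%:R)
    * \prod_((l.+1)./2 <= p < l - k) (mu + p%:R) = gcoef mu k (l - 2 * k).
Proof.
move=> kl; rewrite /gcoef /gpref /rising; congr (_ * _).
rewrite -{1}[(l.+1)./2]add0n big_addn big_mkord.
have -> : (k + uphalf (l - 2 * k) = (l.+1)./2)%N by lia.
have -> : (l - k - (l.+1)./2 = (l - 2 * k)./2)%N by lia.
by apply: eq_bigr => p _; rewrite natrD addrA addrAC.
Qed.

Lemma tangential_Dop (mu : C) (l : int) v w : tangential_part v w ->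
  tangential_part (gegen T Z mu l v) (Dop mu l w).
Proof.
move=> vw J; case: l => [l|l]; last by [].
apply/funext => x; rewrite /gegen /Dop /Dfun fct_sumE smoothfun_sumE.
apply: eq_big_nat => k /andP[_ kl]; rewrite Dfun_coefE //.
transitivity (gcoef mu k (l - 2 * k) * iter k T (iter (l - 2 * k) Z v) J x).
  by [].
congr (_ * _); set q := (l - 2 * k)%N.
have -> : iter q (partial ord_max) (w (emb J)) = smooth_val (iter q Z v J).
  by elim: q => [|q IH] /=; rewrite ?vw ?IH.
suff -> : iter k (@tangential_laplacian R m) (smooth_val (iter q Z v J))
   = smooth_val (iter k T (iter q Z v) J) by [].
by elim: (k) => [|k' IH] //=; rewrite lapE IH.
Qed.

(** The tangential part of a form with smooth coefficients, as an element of the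
    module on which the algebraic identities hold. *)
Definition slice w (sw : forall I, smooth (w I)) : V := fun J => to_smooth (sw (emb J)).

Lemma tangential_slice w (sw : forall I, smooth (w I)) : tangential_part (slice sw) w.
Proof. by []. Qed.

Lemma smooth_contraction w : (forall I, smooth (w I)) ->
  forall I, smooth (Defs.contraction ord_max w I).
Proof.
move=> sw I; rewrite /Defs.contraction; case: (ord_max \in I); first exact: smooth0.
exact: smoothZ.
Qed.

(** This makes the normal term of [d* iota w] vanish. *)
Lemma tangential_contraction2 w :
  tangential_part 0 (Defs.contraction ord_max (Defs.contraction ord_max w)).
Proof.
move=> J; rewrite contraction_emb; apply/funext => x.
by rewrite /Defs.contraction finset.setU11 mulr0.
Qed.

Lemma D_down_slice i u a w (w0 w1 : V) : (forall I, smooth (w I)) ->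
  tangential_part w0 w -> tangential_part w1 (Defs.contraction ord_max w) ->
  D_down i u a w = fun J y =>
    down_op d' ds' T Z (mu_ m i u) (2^-1 * (u + (2 * i)%:R - m.+1%:R)) a w0 w1
      J (hyperplane_incl y).
Proof.
move=> sw h0 h1; rewrite /D_down; apply: rest_tangential.
have h2 := tangential_dstar (smooth_contraction sw) h1 (@tangential_contraction2 w).
rewrite linear0 subr0 in h2.
apply: tangential_add; last by apply: tangential_scale; exact: tangential_Dop.
apply: tangential_add; apply: tangential_opp.
  by apply: tangential_Dop; exact: tangential_ext_d.
by apply: tangential_scale; apply: tangential_Dop; exact: tangential_dstar.
Qed.

Lemma D_same_slice i u a w (w0 w1 : V) : (forall I, smooth (w I)) ->
  tangential_part w0 w -> tangential_part w1 (Defs.contraction ord_max w) ->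
  D_same i u a w = fun J y =>
    same_op d' ds' T Z (mu_ m i u) (2^-1 * (u + a%:R)) a w0 w1
      J (hyperplane_incl y).
Proof.
move=> sw h0 h1; rewrite /D_same; apply: rest_tangential.
apply: tangential_add; last by apply: tangential_scale; exact: tangential_Dop.
apply: tangential_add.
  by apply: tangential_Dop; apply: tangential_ext_d; exact: tangential_dstar.
apply: tangential_opp; apply: tangential_scale; apply: tangential_Dop.
exact: tangential_ext_d.
Qed.

Let tpC j k s : tangential_partial j (tangential_partial k s)
  = tangential_partial k (tangential_partial j s).
Proof. exact: spartial_comm. Qed.

Let npC j s : normal_partial (tangential_partial j s)
  = tangential_partial j (normal_partial s).
Proof. exact: spartial_comm. Qed.

Let dZ v : d' (Z v) = Z (d' v). Proof. exact: (extd_postcomp _ npC). Qed.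
Let dsZ v : ds' (Z v) = Z (ds' v). Proof. exact: (codiff_postcomp _ npC). Qed.
Let dd0 := extd_extd tpC.
Let dsds0 := codiff_codiff tpC.
Let hodge := extd_codiff_anticomm tpC.

Section Factorizations.
Variables (i a : nat) (w : dform R m.+1).
Hypothesis sw : forall I, smooth (w I).
Let h0 := tangential_slice sw.
Let h1 := tangential_slice (smooth_contraction sw).
Let downE u b := D_down_slice i u b sw h0 h1.
Let sameE u b := D_same_slice i u b sw h0 h1.

Lemma ext_d_D_down (u := - a%:R - 1) :
  ext_d (D_down i u a w)
  = form_opp (form_scale (gamma_ (mu_ m i u) a) (D_same i u a.+1 w)).
Proof.
rewrite downE ext_d_rest sameE.
have -> : 2^-1 * (u + (2 * i)%:R - m.+1%:R) = mu_ m i u + a%:R / 2.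
  by rewrite /u /mu_ -natr1 natrM; field.
have -> : 2^-1 * (u + a.+1%:R) = 0 by rewrite /u -natr1; ring.
by apply/funext => J; rewrite (@d_down_op R _ d' ds' T Z dd0 hodge dZ).
Qed.

Lemma ext_d_D_same : ext_d (D_same i (- a%:R) a w) = fun _ _ => 0.
Proof.
rewrite sameE ext_d_rest addNr mulr0.
by apply/funext => J; rewrite (@d_same_op R _ d' ds' T Z dd0 hodge dZ).
Qed.

Lemma dstar_D_same (u := m.+1%:R - (2 * i)%:R - a%:R - 1) :
  dstar (D_same i u a w)
  = form_opp (form_scale (gamma_ (mu_ m i u) a) (D_down i u a.+1 w)).
Proof.
rewrite downE sameE dstar_rest.
have -> : 2^-1 * (u + a%:R) = mu_ m i u + a%:R.
  by rewrite /u /mu_ -natr1 natrM; field.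
have -> : 2^-1 * (u + (2 * i)%:R - m.+1%:R) = - (a.+1%:R / 2).
  by rewrite /u -[a.+1%:R]natr1; field.
by apply/funext => J; rewrite (@ds_same_op R _ d' ds' T Z dsds0 hodge dZ dsZ).
Qed.

Lemma dstar_D_down :
  dstar (D_down i (m.+1%:R - (2 * i)%:R - a%:R) a w) = fun _ _ => 0.
Proof.
rewrite downE dstar_rest.
have -> : 2^-1 * (m.+1%:R - (2 * i)%:R - a%:R + (2 * i)%:R - m.+1%:R) = - (a%:R / 2) :> C.
  by field.
by apply/funext => J; rewrite (@ds_down_op R _ d' ds' T Z dsds0 hodge dZ dsZ).
Qed.

End Factorizations.
End Hyperplane.

(* The dimension is n = m.+1, and n >= 2 reads 0 < m. *)
Theorem theorem13p4 (R : realType) (m : nat) (hm : (0 < m)%N) (a : nat) :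
  let n := m.+1 in
  (forall (i : nat) (w : dform R n), (1 <= i <= n - 1)%N -> smooth_form i w ->
     ext_d (D_down i (- a%:R - 1) a w)
     = form_opp (form_scale (gamma_ (- a%:R + i%:R - (n + 1)%:R / 2) a)
         (D_same i (- a%:R - 1) a.+1 w)))
  /\
  (forall (i : nat) (w : dform R n), (i <= n - 2)%N -> smooth_form i w ->
     ext_d (D_same i (- a%:R) a w) = (fun _ _ => 0))
  /\
  (forall (i : nat) (w : dform R n), (1 <= i <= n - 1)%N -> smooth_form i w ->
     dstar (D_same i (n%:R - (2 * i)%:R - a%:R - 1) a w)
     = form_opp (form_scale (gamma_ (- a%:R - i%:R + (n%:R - 1) / 2) a)
         (D_down i (n%:R - (2 * i)%:R - a%:R - 1) a.+1 w)))
  /\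
  (forall (i : nat) (w : dform R n), (2 <= i <= n)%N -> smooth_form i w ->
     dstar (D_down i (n%:R - (2 * i)%:R - a%:R) a w) = (fun _ _ => 0)).
Proof.
move=> n; rewrite /n; split; last split; last split => [i w _ [sw _]|i w _ [sw _]].
- move=> i w _ [sw _]; rewrite ext_d_D_down //.
  congr (form_opp (form_scale (gamma_ _ _) _)).
  by rewrite /mu_ addn1 -!natr1; field.
- by move=> i w _ [sw _]; exact: ext_d_D_same.
- rewrite dstar_D_same //; congr (form_opp (form_scale (gamma_ _ _) _)).
  by rewrite /mu_ -!natr1 natrM; field.
- exact: dstar_D_down.
Qed.
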